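(* For every integer $n\ge 2$, $b_3(n+1)=b_2(n)$.
   Context: $K_n$ denotes the complete graph on $n$ vertices. A biclique is a complete bipartite graph; a biclique on a subset of $V(K_n)$ is given by two disjoint sets $X,Y\subseteq V(K_n)$, its edges being all pairs $xy$ with $x\in X$, $y\in Y$. An odd cover of $K_n$ is a finite collection of bicliques on subsets of $V(K_n)$ such that every edge of $K_n$ belongs to an odd number of the bicliques in the collection. $b_2(n)$ denotes the minimum number of bicliques in an odd cover of $K_n$. $K_n^{(3)}$ denotes the complete $3$-uniform hypergraph on $n$ vertices (its edges are all $3$-element subsets of the vertex set). A complete $3$-partite $3$-graph is given by three pairwise disjoint vertex sets $A_1,A_2,A_3$; its edges are those $3$-sets contained in $A_1\cup A_2\cup A_3$ that meet every $A_i$ (hence contain exactly one element of each $A_i$). An odd cover of $K_n^{(3)}$ is a finite family of complete $3$-partite $3$-graphs on subsets of $V(K_n^{(3)})$ such that every $3$-element subset of $V(K_n^{(3)})$ is an edge of an odd number of members of the family. $b_3(n)$ denotes the minimum size of an odd cover of $K_n^{(3)}$. *)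

(* Defs.v *)
From HB Require Import structures.
From mathcomp Require Import all_boot.

Set Implicit Arguments.
Unset Strict Implicit.
Unset Printing Implicit Defensive.

Definition complete_graph_edges (n : nat) : {set {set 'I_n}} :=
  [set e : {set 'I_n} | #|e| == 2].

(* Empty parts are allowed; such a biclique has no edge, so this does not
   affect minimum cover sizes. *)
Definition biclique (n : nat) : Type :=
  {p : {set 'I_n} * {set 'I_n} | [disjoint p.1 & p.2]}.

Definition biclique_edges (n : nat) (B : biclique n) : {set {set 'I_n}} :=
  let: (X, Y) := val B in [set [set x; y] | x in X, y in Y].

Definition complete_3graph_edges (n : nat) : {set {set 'I_n}} :=
  [set e : {set 'I_n} | #|e| == 3].

Definition pairwise_disjoint3 (n : nat)
    (p : {set 'I_n} * {set 'I_n} * {set 'I_n}) : bool :=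
  let: (A1, A2, A3) := p in
  [&& [disjoint A1 & A2], [disjoint A1 & A3] & [disjoint A2 & A3]].

Definition tripartite (n : nat) : Type :=
  {p : {set 'I_n} * {set 'I_n} * {set 'I_n} | pairwise_disjoint3 p}.

Definition tripartite_edges (n : nat) (H : tripartite n) : {set {set 'I_n}} :=
  let: (A1, A2, A3) := val H in
  [set e : {set 'I_n} | [&& #|e| == 3, e \subset A1 :|: A2 :|: A3,
     e :&: A1 != set0, e :&: A2 != set0 & e :&: A3 != set0]].

(* Collections are sequences, so repeated members are counted with
   multiplicity. *)
Definition odd_cover2 (n : nat) (s : seq (biclique n)) : bool :=
  [forall e in complete_graph_edges n,
     odd (count (fun B => e \in biclique_edges B) s)].

Definition odd_cover3 (n : nat) (s : seq (tripartite n)) : bool :=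
  [forall e in complete_3graph_edges n,
     odd (count (fun H => e \in tripartite_edges H) s)].

Lemma odd_cover_by_edges (S B : finType) (D : {set S}) (E : B -> {set S}) :
    (forall e, e \in D -> exists b, E b = [set e]) ->
  exists k, [exists s : k.-tuple B,
    [forall e in D, odd (count (fun b => e \in E b) s)]].
Proof.
move=> hE; have [s hs] : exists s : seq B, map E s = map set1 (enum D).
  have: {subset enum D <= D} by move=> e; rewrite mem_enum.
  elim: (enum D) => [|e r IH] hr; first by exists [::].
  have [|s hs] := IH; first by move=> x xr; apply: hr; rewrite inE xr orbT.
  have [b hb] := hE e (hr e (mem_head _ _)).
  by exists (b :: s); rewrite /= hb hs.
exists (size s); apply/existsP; exists (in_tuple s); apply/forall_inP => e eD.
have -> : count (fun b => e \in E b) s = count (fun A : {set S} => e \in A) (map E s).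
  by rewrite count_map.
rewrite hs count_map (eq_count (a2 := pred1 e)); last first.
  by move=> x /=; rewrite inE eq_sym.
by rewrite count_uniq_mem ?enum_uniq // mem_enum eD.
Qed.

Lemma odd_cover2_exists (n : nat) :
  exists k, [exists s : k.-tuple (biclique n), odd_cover2 s].
Proof.
apply: odd_cover_by_edges => e; rewrite inE => /cards2P[x [y [xy ->]]].
have d : [disjoint ([set x], [set y]).1 & ([set x], [set y]).2].
  by rewrite /= disjoints1 inE.
exists (exist _ ([set x], [set y]) d); rewrite /biclique_edges /=.
apply/setP => f; rewrite inE; apply/imset2P/eqP.
  by case=> u v; rewrite !inE => /eqP-> /eqP-> ->.
by move=> ->; exists x y; rewrite ?inE.
Qed.

Lemma odd_cover3_exists (n : nat) :
  exists k, [exists s : k.-tuple (tripartite n), odd_cover3 s].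
Proof.
apply: odd_cover_by_edges => e; rewrite inE => e3.
have /card_gt0P[x xe] : 0 < #|e| by rewrite (eqP e3).
have : #|e :\ x| == 2 by move: e3; rewrite (cardsD1 x) xe.
case/cards2P=> y [z [yz exE]].
have : x \notin [set y; z] by rewrite -exE !inE eqxx.
rewrite !inE negb_or => /andP[xy xz].
have eE : e = [set x] :|: [set y] :|: [set z] by rewrite -setUA -exE setD1K.
have d : pairwise_disjoint3 ([set x], [set y], [set z]).
  by rewrite /= !disjoints1 !inE xy xz yz.
exists (exist _ ([set x], [set y], [set z]) d).
rewrite /tripartite_edges /= -eE.
apply/setP => f; rewrite !inE; apply/idP/eqP => [|->].
  case/and5P=> f3 fe _ _ _; apply/eqP.
  by rewrite eqEcard fe (eqP f3) (eqP e3).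
rewrite e3 subxx /= eE.
by apply/and3P; split; apply/set0Pn; [exists x|exists y|exists z];
  rewrite !inE eqxx ?orbT.
Qed.

Definition b2 (n : nat) : nat := ex_minn (odd_cover2_exists n).
Definition b3 (n : nat) : nat := ex_minn (odd_cover3_exists n).

(* Main.v *)
(* An odd cover of the triples on n+1 points yields one of the pairs on n
   points by taking links at a fixed vertex.  Conversely, a biclique (X, Y)
   extends to the tripartite 3-graph whose third part consists of all remaining
   vertices, the new one included.  A triple {x, y, z} of old vertices meets all
   three parts iff the biclique contains an odd number of the pairs xy, xz, yz,
   so it is covered odd + odd + odd = odd many times. *)
Require Import Defs.
From HB Require Import structures.
From mathcomp Require Import all_boot.

Set Implicit Arguments.
Unset Strict Implicit.
Unset Printing Implicit Defensive.

(** Parity of a count is linear over the field with two elements. This turns the memberwise identity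
    of [mem_extension_edges] into one about covering multiplicities. *)
Lemma odd_count_addb (T : Type) (a b : pred T) (s : seq T) :
  odd (count (fun x => a x (+) b x) s) = odd (count a s) (+) odd (count b s).
Proof.
elim: s => //= x s IH; rewrite !oddD IH !oddb.
by case: (a x); case: (b x); case: (odd (count a s)); case: (odd (count b s)).
Qed.

Lemma disjoint_andF (T : finType) (A B : {set T}) x :
  [disjoint A & B] -> (x \in A) && (x \in B) = false.
Proof. by move/pred0P/(_ x). Qed.

Lemma mem_biclique_edges n (B : biclique n) (x y : 'I_n) :
  ([set x; y] \in biclique_edges B) =
  (x \in (val B).1) && (y \in (val B).2) || (y \in (val B).1) && (x \in (val B).2).
Proof.
rewrite /biclique_edges; case: B => -[X Y] /= dXY.
apply/imset2P/orP => [[u v uX vY E]|[]/andP[hx hy]]; last 2 first.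
- by exists x y.
- by exists y x; rewrite // setUC.
(* Disjointness of the parts forces [u != v], leaving only the two bijective matchings of [u], [v]
   with [x], [y]. *)
have uv : u != v by apply: contraTneq vY => <-; rewrite (disjointFr dXY uX).
have: u \in [set x; y] by rewrite E !inE eqxx.
have: v \in [set x; y] by rewrite E !inE eqxx orbT.
rewrite !inE => /orP[]/eqP ev /orP[]/eqP eu; subst u v; rewrite ?eqxx // in uv.
- by right; rewrite uX.
- by left; rewrite uX.
Qed.

Lemma cards_set3 (T : finType) (x y z : T) :
  x != y -> x != z -> y != z -> #|[set x; y; z]| = 3.
Proof.
by move=> xy xz yz; rewrite setUC cardsU1 cards2 xy !inE negb_or ![z == _]eq_sym xz yz.
Qed.

(** Distinctness settles the cardinality condition, so edge membership becomes a Boolean formula in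
    nine vertex-in-part atoms, which later proofs decide by cases. *)
Lemma mem_tripartite_edges n (H : tripartite n) (x y z : 'I_n) :
    x != y -> x != z -> y != z ->
  let: (A1, A2, A3) := val H in
  ([set x; y; z] \in tripartite_edges H) =
  [&& all (mem (A1 :|: A2 :|: A3)) [:: x; y; z], has (mem A1) [:: x; y; z],
      has (mem A2) [:: x; y; z] & has (mem A3) [:: x; y; z]].
Proof.
move=> xy xz yz; rewrite /tripartite_edges; case: H => -[[A1 A2] A3] /= _.
have meet (A : {set 'I_n}) : ([set x; y; z] :&: A != set0) = has (mem A) [:: x; y; z].
  apply/set0Pn/hasP => -[u].
    by rewrite !inE -orbA => /andP[ue uA]; exists u; rewrite // !inE.
  by rewrite !inE => ue uA; exists u; rewrite !inE -orbA ue.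
rewrite inE cards_set3 // eqxx !meet.
by rewrite !subUset !sub1set /= andbT -!andbA.
Qed.

Section Link.

Variable n : nat.
Implicit Type H : tripartite n.+1.

Let trace (A : {set 'I_n.+1}) : {set 'I_n} := lift ord0 @^-1: A.

(** Disjointness puts [ord0] in at most one part, so the order of the tests is immaterial. If it is
    in none, no edge contains it and the edgeless biclique is the right default. *)
Definition link_parts H : {set 'I_n} * {set 'I_n} :=
  let: (A1, A2, A3) := val H in
  if ord0 \in A1 then (trace A2, trace A3)
  else if ord0 \in A2 then (trace A1, trace A3)
  else if ord0 \in A3 then (trace A1, trace A2)
  else (set0, set0).

Lemma disjoint_link_parts H : [disjoint (link_parts H).1 & (link_parts H).2].
Proof.
have dtrace (A B : {set _}) : [disjoint A & B] -> [disjoint trace A & trace B].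
  by move=> dAB; apply/pred0P => x; rewrite /= !inE disjoint_andF.
rewrite /link_parts; case: H => -[[A1 A2] A3] /= /and3P[d12 d13 d23].
by do !case: ifP => _; rewrite /= ?dtrace // -setI_eq0 setI0.
Qed.

Definition link H : biclique n := exist _ (link_parts H) (disjoint_link_parts H).

Lemma mem_link_edges H (x y : 'I_n) : x != y ->
  ([set x; y] \in biclique_edges (link H)) =
  ([set ord0; lift ord0 x; lift ord0 y] \in tripartite_edges H).
Proof.
move=> xy; rewrite mem_biclique_edges /link /= /link_parts.
have := @mem_tripartite_edges _ H ord0 (lift ord0 x) (lift ord0 y).
case: H => -[[A1 A2] A3] /= /and3P[d12 d13 d23] ->; rewrite ?(inj_eq lift_inj) //.
(* Pointwise disjointness at the three vertices discards the truth assignments that put a vertex in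
   two parts. *)
have := (disjoint_andF ord0 d12, disjoint_andF ord0 d13, disjoint_andF ord0 d23).
have := (disjoint_andF (lift ord0 x) d12, disjoint_andF (lift ord0 x) d13,
         disjoint_andF (lift ord0 x) d23).
have := (disjoint_andF (lift ord0 y) d12, disjoint_andF (lift ord0 y) d13,
         disjoint_andF (lift ord0 y) d23).
rewrite !inE.
case: (ord0 \in A1); case: (ord0 \in A2); case: (ord0 \in A3) => //=;
  rewrite !inE; case: (lift ord0 x \in A1); case: (lift ord0 x \in A2);
  case: (lift ord0 x \in A3); case: (lift ord0 y \in A1);
  by case: (lift ord0 y \in A2); case: (lift ord0 y \in A3) => //= -[[? ?] ?] [[? ?] ?] [[? ?] ?].
Qed.

Lemma odd_cover2_link (s : seq (tripartite n.+1)) :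
  odd_cover3 s -> odd_cover2 (map link s).
Proof.
move/forall_inP=> cov; apply/forall_inP => e; rewrite inE => /cards2P[x [y [xy ->]]].
rewrite count_map (eq_count (fun H => mem_link_edges H xy)); apply: cov.
by rewrite inE cards_set3 ?(inj_eq lift_inj).
Qed.

End Link.

Section Extension.

Variable n : nat.
Implicit Type B : biclique n.

Definition extension_parts B : {set 'I_n.+1} * {set 'I_n.+1} * {set 'I_n.+1} :=
  let X := lift ord0 @: (val B).1 in let Y := lift ord0 @: (val B).2 in
  (X, Y, ~: (X :|: Y)).

Lemma disjoint_extension_parts B : pairwise_disjoint3 (extension_parts B).
Proof.
rewrite /extension_parts; case: B => -[X Y] /= dXY.
rewrite (imset_disjoint (@lift_inj _ ord0)) dXY.
by rewrite !disjoints_subset !setCK subsetUl subsetUr.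
Qed.

Definition extension B : tripartite n.+1 :=
  exist _ (extension_parts B) (disjoint_extension_parts B).

Lemma ord0_notin_lift (A : {set 'I_n}) : (ord0 \in lift ord0 @: A) = false.
Proof. by apply/imsetP => -[x _ /eqP]; rewrite (negPf (neq_lift _ _)). Qed.

(** Since [lift ord0] misses [ord0], the new vertex always lies in the third part, so the two old
    vertices must meet the other two. *)
Lemma mem_extension_edges0 B (x y : 'I_n) : x != y ->
  ([set ord0; lift ord0 x; lift ord0 y] \in tripartite_edges (extension B)) =
  ([set x; y] \in biclique_edges B).
Proof.
move=> xy; rewrite mem_biclique_edges.
have := @mem_tripartite_edges _ (extension B) ord0 (lift ord0 x) (lift ord0 y).
rewrite /= => ->; rewrite ?(inj_eq lift_inj) //.
case: B => -[X Y] /= dXY; rewrite !inE !ord0_notin_lift !(mem_imset _ _ lift_inj).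
have := (disjoint_andF x dXY, disjoint_andF y dXY).
by case: (x \in X); case: (x \in Y); case: (y \in X); case: (y \in Y) => // -[].
Qed.

(** If a of the three vertices lie in one side of [B] and b in the other, the biclique contains ab
    of the pairs. As a + b <= 3, ab is odd only for a = b = 1, and then the remaining vertex lies in
    the third part. *)
Lemma mem_extension_edges B (x y z : 'I_n) : x != y -> x != z -> y != z ->
  ([set lift ord0 x; lift ord0 y; lift ord0 z] \in tripartite_edges (extension B)) =
  ([set x; y] \in biclique_edges B) (+)
    (([set x; z] \in biclique_edges B) (+) ([set y; z] \in biclique_edges B)).
Proof.
move=> xy xz yz; rewrite !mem_biclique_edges.
have := @mem_tripartite_edges _ (extension B) (lift ord0 x) (lift ord0 y) (lift ord0 z).
rewrite /= => ->; rewrite ?(inj_eq lift_inj) //.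
case: B => -[X Y] /= dXY; rewrite !inE !(mem_imset _ _ lift_inj).
have := (disjoint_andF x dXY, disjoint_andF y dXY, disjoint_andF z dXY).
by case: (x \in X); case: (x \in Y); case: (y \in X); case: (y \in Y);
  case: (z \in X); case: (z \in Y) => // -[[]].
Qed.

Lemma odd_cover3_extension (s : seq (biclique n)) :
  odd_cover2 s -> odd_cover3 (map extension s).
Proof.
move/forall_inP=> cov.
have {}cov x y : x != y -> odd (count (fun B => [set x; y] \in biclique_edges B) s).
  by move=> xy; apply: cov; rewrite inE cards2 xy.
have cov0 x y : x != y ->
    odd (count (fun H => [set ord0; lift ord0 x; lift ord0 y] \in tripartite_edges H)
           (map extension s)).
  move=> xy; rewrite count_map (eq_count (fun B => mem_extension_edges0 B xy)).
  exact: cov.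
apply/forall_inP => e; rewrite inE => e3.
(* A triple through [ord0] inherits the multiplicity of one old pair. Any other triple consists of
   lifted vertices, and its parity is the sum of those of its three pairs. *)
have [e0|e0] := boolP (ord0 \in e).
  have : #|e :\ ord0| == 2 by move: e3; rewrite (cardsD1 ord0) e0.
  case/cards2P=> y [z [yz eyz]].
  have : ord0 \notin [set y; z] by rewrite -eyz !inE eqxx.
  rewrite -(setD1K e0) eyz !inE negb_or setUA.
  case: (unliftP ord0 y) yz {eyz} => [j ->|->]; last by rewrite eqxx.
  case: (unliftP ord0 z) => [k ->|->]; last by rewrite eqxx andbF.
  by rewrite (inj_eq lift_inj) => jk _; apply: cov0.
have /card_gt0P[x xe] : 0 < #|e| by rewrite (eqP e3).
have : #|e :\ x| == 2 by move: e3; rewrite (cardsD1 x) xe.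
case/cards2P=> y [z [yz eyz]].
have : x \notin [set y; z] by rewrite -eyz !inE eqxx.
move: e0; rewrite -(setD1K xe) eyz !inE !negb_or setUA => /and3P[].
case: (unliftP ord0 x) => [i ->|->] //.
case: (unliftP ord0 y) yz {eyz} => [j ->|->] //.
case: (unliftP ord0 z) => [k ->|->] //.
rewrite !(inj_eq lift_inj) => jk _ _ _ /andP[ij ik].
rewrite count_map (eq_count (fun B => mem_extension_edges B ij ik jk)).
by rewrite !odd_count_addb !cov.
Qed.

End Extension.

Theorem theorem7 : forall n : nat, 2 <= n -> b3 n.+1 = b2 n.
Proof.
move=> n _; apply/eqP; rewrite eqn_leq /b3 /b2; apply/andP.
case: ex_minnP => k /existsP[s cov_s] min_k; case: ex_minnP => l /existsP[t cov_t] min_l.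
split.
  (* Mapping preserves the length of the tuple, so each minimum is tested against a cover of the
     other's size. *)
  apply: min_k; apply/existsP; exists (map_tuple (@extension n) t).
  exact: odd_cover3_extension.
apply: min_l; apply/existsP; exists (map_tuple (@link n) s).
exact: odd_cover2_link.
Qed.
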